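(* Let $T$ be a tomographically local GPT and let $sT$ be a swirled version of $T$. A causal structure admits of an $sT$-$T$ gap only if it is nonalgebraic.
   Context: GPT. A tomographically local GPT $T$ consists of a collection of systems closed under composition (with a trivial system); each system $S$ has a finite-dimensional real vector space $V_S$, with $V_{AB}=V_A\otimes V_B$ and $V_{\rm trivial}=\mathbb{R}$. For each pair $A,B$ there is a convex set of linear maps $V_A\to V_B$, the (valid) transformations; states are the transformations from the trivial system and effects those to the trivial system. States span $V_S$ and effects span its dual. Transformations contain identities and swaps and are closed under sequential and parallel composition; every closed circuit evaluates to a number in $[0,1]$. Each system has a unit effect $u_S$ with $u_{AB}=u_A\otimes u_B$; a transformation $\mathcal{E}:A\to B$ is deterministic if $u_B\circ\mathcal{E}=u_A$. $T$ contains classical probability theory (CPT): for each finite set $X$ there is a classical system with $V=\mathbb{R}^X$, transformations between classical systems being exactly the substochastic matrices (deterministic: stochastic matrices), and transformations can be conditioned on classical systems. Swirling. A symmetry of $T$ is a finite group $G$ with, for each system $S$, a representation $g\mapsto\mathcal{F}^S_g$ by invertible linear maps on $V_S$, acting collectively on composites ($\mathcal{F}^{AB}_g=\mathcal{F}^A_g\otimes\mathcal{F}^B_g$), trivially on classical systems, preserving the sets of states and of effects and the unit effect, and mapping transformations to transformations by conjugation. It is nonphysical if some $\mathcal{F}^S_g$ is not a valid transformation of $T$. The swirled theory $sT$ for a nonphysical symmetry is the subtheory of $T$ with all and only the invariant states and effects and all and only the covariant transformations ($\mathcal{E}\circ\mathcal{F}^A_g=\mathcal{F}^B_g\circ\mathcal{E}$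 for all $g$). Causal structures. A causal structure (with unrestricted gates) is a finite directed acyclic circuit shape consisting of gates connected by wires. Each wire is either latent (stipulated to be a GPT wire or a classical wire) or an observed classical variable. Each observed variable is either an open input or the output of exactly one gate; it may be copied and fed to any number of gates (acyclically), and each observed variable output by a gate is an open output. Each latent wire is the output of exactly one gate and the input of exactly one gate. For a theory $T'$ ($T$, $sT$ or CPT), open inputs $\mathbf{I}$ and open outputs $\mathbf{O}$ with finite alphabets, $P(\mathbf{O}|\mathbf{I})$ is $T'$-realizable in the causal structure if one can assign systems of $T'$ to latent GPT wires, finite classical systems to latent classical wires, and deterministic transformations of $T'$ to gates so that the circuit yields $P(\mathbf{O}|\mathbf{I})$. The causal structure admits of an $sT$-$T$ gap if the set of $T$-realizable distributions is a strict superset of the set of $sT$-realizable distributions (for some finite alphabets). Algebraic. A causal structure is algebraic if it does not impose any inequality constraints on the distributions that are CPT-realizable in it, i.e. it imposes only equality constraints: for all choices of finite alphabets of the observed variables, the set of CPT-realizable conditional distributions $P(\mathbf{O}|\mathbf{I})$ is exactly the set of all conditional distributions satisfying some set of (polynomial) equality constraints. The relevant equality constraints are conditional independence constraints and nested Markov constraints. A causal structure is nonalgebraic if it is not algebraic. *)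

(* Defs.v *)
From HB Require Import structures.
From mathcomp Require Import all_boot all_order all_algebra all_fingroup reals.
From mathcomp Require mpoly.

Set Implicit Arguments.
Unset Strict Implicit.
Unset Printing Implicit Defensive.

Import Order.TTheory GRing.Theory Num.Theory.
Local Open Scope ring_scope.

(* R^I, the real vector space with standard basis indexed by I.               *)
Notation vec R I := {ffun I -> R^o}.

Section LinearMaps.
Variable R : realType.
Implicit Types I J K : finType.

Definition basis_vec I (a : I) : vec R I := [ffun i => (i == a)%:R].

Definition entry I J (f : 'Hom(vec R I, vec R J)) (b : J) (a : I) : R :=
  f (basis_vec a) b.

Definition hom_of I J (M : J -> I -> R) : 'Hom(vec R I, vec R J) :=
  linfun (fun v : vec R I => [ffun b => \sum_a M b a * v a] : vec R J).

Definition relabel I J (h : I -> J) : 'Hom(vec R I, vec R J) :=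
  hom_of (fun b a => (b == h a)%:R).

Definition substochastic I J (f : 'Hom(vec R I, vec R J)) : Prop :=
  (forall b a, 0 <= entry f b a) /\ (forall a, \sum_b entry f b a <= 1).

End LinearMaps.

(* The data of a circuit theory with classical systems. Every system S comes  *)
(* with coordinates V_S = R^(bas S); split/join identify the basis of a       *)
(* composite with the product basis, so that V_(AB) is the tensor product of  *)
(* V_A and V_B. No axiom on [valid] is part of the data: the GPT T, its       *)
(* swirled subtheory and classical probability theory all have this type.     *)
Record theory (R : realType) := Theory {
  sys : Type;
  triv : sys;
  comp : sys -> sys -> sys;
  cl : finType -> sys;
  bas : sys -> finType;
  pt : bas triv;
  pt_unique : forall x : bas triv, x = pt;
  split : forall A B, bas (comp A B) -> bas A * bas B;
  join : forall A B, bas A * bas B -> bas (comp A B);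
  splitK : forall A B, cancel (@split A B) (@join A B);
  joinK : forall A B, cancel (@join A B) (@split A B);
  cl_in : forall X : finType, X -> bas (cl X);
  cl_out : forall X : finType, bas (cl X) -> X;
  cl_inK : forall X, cancel (@cl_in X) (@cl_out X);
  cl_outK : forall X, cancel (@cl_out X) (@cl_in X);
  unit_eff : forall S, 'Hom(vec R (bas S), vec R (bas triv));
  valid : forall A B, 'Hom(vec R (bas A), vec R (bas B)) -> Prop
}.

Arguments sys {R} _.
Arguments triv {R} _.
Arguments comp {R} _ _ _.
Arguments cl {R} _ _.
Arguments bas {R} _ _.
Arguments pt {R} _.
Arguments split {R} _ {A B} _.
Arguments join {R} _ {A B} _.
Arguments cl_in {R} _ {X} _.
Arguments cl_out {R} _ {X} _.
Arguments unit_eff {R} _ _.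
Arguments valid {R} _ {A B} _.

Section Theory.
Variables (R : realType) (T : theory R).
Implicit Types A B C D S : sys T.

Notation "A ⊗ B" := (comp T A B) (at level 40, left associativity).
Notation hom A B := 'Hom(vec R (bas T A), vec R (bas T B)).

Definition tensor A B C D (f : hom A C) (g : hom B D) : hom (A ⊗ B) (C ⊗ D) :=
  hom_of (fun y x => entry f (split T y).1 (split T x).1
                   * entry g (split T y).2 (split T x).2).

Definition deterministic A B (f : hom A B) : Prop :=
  (unit_eff T B \o f)%VF = unit_eff T A.

(* Composites of classical systems (the trivial system being R^1) are again   *)
(* classical.                                                                 *)
Inductive classical : sys T -> Prop :=
| classical_cl X : classical (cl T X)
| classical_triv : classical (triv T)
| classical_comp A B : classical A -> classical B -> classical (A ⊗ B).

Definition swap A B : hom (A ⊗ B) (B ⊗ A) :=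
  relabel R (fun x => join T ((split T x).2, (split T x).1)).

(* The canonical identifications (AB)C = A(BC) and A = A(triv), in both       *)
(* directions.                                                                *)
Definition assoc A B C : hom ((A ⊗ B) ⊗ C) (A ⊗ (B ⊗ C)) :=
  relabel R (fun x => let ab := split T (split T x).1 in
                      join T (ab.1, join T (ab.2, (split T x).2))).

Definition assoc_inv A B C : hom (A ⊗ (B ⊗ C)) ((A ⊗ B) ⊗ C) :=
  relabel R (fun x => let bc := split T (split T x).2 in
                      join T (join T ((split T x).1, bc.1), bc.2)).

Definition unitor A : hom (A ⊗ triv T) A :=
  relabel R (fun x => (split T x).1).

Definition unitor_inv A : hom A (A ⊗ triv T) :=
  relabel R (fun a => join T (a, pt T)).

(* Apply E x when the classical control system takes the value x.             *)
Definition conditioned (X : finType) A B (E : X -> hom A B) :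
    hom (cl T X ⊗ A) B :=
  hom_of (fun b xa => entry (E (cl_out T (split T xa).1)) b (split T xa).2).

Record tomographically_local_gpt : Prop := {
  gpt_convex : forall A B (f g : hom A B) (t : R), 0 <= t <= 1 ->
    valid T f -> valid T g -> valid T (t *: f + (1 - t) *: g);
  gpt_id : forall A, valid T (\1%VF : hom A A);
  gpt_swap : forall A B, valid T (swap A B);
  gpt_assoc : forall A B C, valid T (assoc A B C);
  gpt_assoc_inv : forall A B C, valid T (assoc_inv A B C);
  gpt_unitor : forall A, valid T (unitor A);
  gpt_unitor_inv : forall A, valid T (unitor_inv A);
  gpt_seq : forall A B C (f : hom A B) (g : hom B C),
    valid T f -> valid T g -> valid T (g \o f)%VF;
  gpt_par : forall A B C D (f : hom A C) (g : hom B D),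
    valid T f -> valid T g -> valid T (tensor f g);
  gpt_closed : forall c : hom (triv T) (triv T),
    valid T c -> 0 <= entry c (pt T) (pt T) <= 1;
  (* Hom(V_triv, V_S) is V_S and Hom(V_S, V_triv) is the dual of V_S. *)
  gpt_states : forall S, exists2 s : seq (hom (triv T) S),
    (forall f, f \in s -> valid T f) & <<s>>%VS = fullv;
  gpt_effects : forall S, exists2 s : seq (hom S (triv T)),
    (forall e, e \in s -> valid T e) & <<s>>%VS = fullv;
  gpt_unit : forall S, valid T (unit_eff T S);
  gpt_unit_comp : forall A B (x : bas T (A ⊗ B)),
    entry (unit_eff T (A ⊗ B)) (pt T) x =
    entry (unit_eff T A) (pt T) (split T x).1
    * entry (unit_eff T B) (pt T) (split T x).2;
  (* On classical systems the unit effect is summation over all outcomes, so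
     that deterministic means stochastic there. *)
  gpt_unit_classical : forall S (a : bas T S), classical S ->
    entry (unit_eff T S) (pt T) a = 1;
  gpt_classical : forall A B (f : hom A B), classical A -> classical B ->
    valid T f <-> substochastic f;
  gpt_conditioned : forall (X : finType) A B (E : X -> hom A B),
    (forall x, valid T (E x)) -> valid T (conditioned E)
}.

Section Swirling.
Variables (gT : finGroupType).
Variable F : forall S : sys T, gT -> 'End(vec R (bas T S)).

Record symmetry : Prop := {
  sym_1 : forall S, F S 1%g = \1%VF;
  sym_mul : forall S g h, F S (g * h)%g = (F S g \o F S h)%VF;
  sym_comp : forall A B g, F (A ⊗ B) g = tensor (F A g) (F B g);
  sym_classical : forall S g, classical S -> F S g = \1%VF;
  sym_state : forall S g (s : hom (triv T) S),
    valid T s -> valid T (F S g \o s)%VF;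
  sym_effect : forall S g (e : hom S (triv T)),
    valid T e -> valid T (e \o F S g)%VF;
  sym_unit : forall S g, (unit_eff T S \o F S g)%VF = unit_eff T S;
  sym_conj : forall A B g (f : hom A B),
    valid T f -> valid T (F B g \o f \o F A g^-1%g)%VF
}.

Definition nonphysical : Prop := exists S g, ~ valid T (F S g).

Definition covariant A B (f : hom A B) : Prop :=
  forall g, (f \o F A g)%VF = (F B g \o f)%VF.

(* Since F is trivial on the trivial system, a covariant state (effect) is    *)
(* precisely an invariant one.                                                *)
Definition swirl : theory R :=
  {| sys := sys T; triv := triv T; comp := comp T; cl := cl T; bas := bas T;
     pt := pt T; pt_unique := @pt_unique R T;
     split := @split R T; join := @join R T;
     splitK := @splitK R T; joinK := @joinK R T;
     cl_in := @cl_in R T; cl_out := @cl_out R T;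
     cl_inK := @cl_inK R T; cl_outK := @cl_outK R T;
     unit_eff := unit_eff T;
     valid := fun A B f => valid T f /\ covariant f |}.

End Swirling.

End Theory.

Definition cpt (R : realType) : theory R :=
  {| sys := finType;
     triv := unit : finType;
     comp := fun X Y => (X * Y)%type : finType;
     cl := id;
     bas := id;
     pt := tt;
     pt_unique := fun x => let: tt := x in erefl;
     split := fun _ _ => id;
     join := fun _ _ => id;
     splitK := fun _ _ _ => erefl;
     joinK := fun _ _ _ => erefl;
     cl_in := fun _ => id;
     cl_out := fun _ => id;
     cl_inK := fun _ _ => erefl;
     cl_outK := fun _ _ => erefl;
     unit_eff := fun _ => hom_of (fun _ _ => 1);
     valid := fun _ _ f => substochastic f |}.

(* [is_gpt l] says that the latent wire l is a GPT wire, and otherwise it is  *)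
(* stipulated to be classical. An observed variable v is an open input when   *)
(* [producer v = None], and all other observed variables are open outputs; v  *)
(* is copied to all gates of [feeds v].                                       *)
Record causal_structure := CausalStructure {
  gate : finType;
  latent : finType;
  obs : finType;
  is_gpt : latent -> bool;
  src : latent -> gate;
  dst : latent -> gate;
  producer : obs -> option gate;
  feeds : obs -> {set gate};
  arrow : rel gate := fun g h =>
    [exists l, (src l == g) && (dst l == h)]
    || [exists v, (producer v == Some g) && (h \in feeds v)];
  acyclic : forall p : seq gate, path.cycle arrow p -> p = [::]
}.

Section CausalStructure.
Variables (R : realType) (C : causal_structure).

Definition wire : finType := (latent C + obs C)%type.

Definition gate_in (g : gate C) : seq wire :=
  enum [pred w : wire | match w with
                        | inl l => dst l == g
                        | inr v => g \in feeds v
                        end].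

Definition gate_out (g : gate C) : seq wire :=
  enum [pred w : wire | match w with
                        | inl l => src l == g
                        | inr v => producer v == Some g
                        end].

Definition open_input (v : obs C) : bool := producer v == None.

Section Realizability.
Variable al : obs C -> finType.

Definition assignment : finType := {dffun forall v : obs C, al v}.

Definition input_assignment : finType :=
  {dffun forall v : {v : obs C | open_input v}, al (val v)}.

Definition agrees (x : assignment) (i : input_assignment) : bool :=
  [forall v, x (val v) == i v].

(* P(O|I), with P x the probability of the outputs in x given the inputs in x.*)
Record cond_dist := CondDist {
  prob :> assignment -> R;
  prob_ge0 : forall x, 0 <= prob x;
  prob_sum1 : forall i : input_assignment, \sum_(x | agrees x i) prob x = 1
}.

Section Circuit.
Variables (T : theory R) (sy : latent C -> sys T).

Definition wire_sys (w : wire) : sys T :=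
  match w with inl l => sy l | inr v => cl T (al v) end.

Fixpoint bundle (ws : seq wire) : sys T :=
  if ws is w :: ws' then comp T (wire_sys w) (bundle ws') else triv T.

Definition wire_val (b : {dffun forall l, bas T (sy l)}) (x : assignment)
    (w : wire) : bas T (wire_sys w) :=
  match w with inl l => b l | inr v => cl_in T (x v) end.

Fixpoint bundle_val (val_of : forall w, bas T (wire_sys w)) (ws : seq wire) :
    bas T (bundle ws) :=
  match ws return bas T (bundle ws) with
  | [::] => pt T
  | w :: ws' => join T (val_of w, bundle_val val_of ws')
  end.

Definition gate_maps : Type :=
  forall g, 'Hom(vec R (bas T (bundle (gate_in g))),
                 vec R (bas T (bundle (gate_out g)))).

(* Composing the gates along the wires: in coordinates, the product of the    *)
(* gates' matrix entries is summed over the basis indices of all latent wires,*)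
(* the (copied) classical observed wires being fixed to their values in x.    *)
Definition circuit_value (E : gate_maps) (x : assignment) : R :=
  \sum_(b : {dffun forall l, bas T (sy l)})
    \prod_(g : gate C)
      entry (E g) (bundle_val (wire_val b x) (gate_out g))
                  (bundle_val (wire_val b x) (gate_in g)).

End Circuit.

Definition realizable (T : theory R) (P : cond_dist) : Prop :=
  exists (sy : latent C -> sys T) (E : gate_maps sy),
    [/\ forall l, ~~ is_gpt l -> classical (sy l),
        forall g, valid T (E g) /\ deterministic (E g)
      & forall x, P x = circuit_value E x].

(* Polynomials in the numbers P x, one variable for each assignment x.        *)
Definition prob_poly : Type := mpoly.mpoly #|assignment| R.

Definition satisfies (P : cond_dist) (p : prob_poly) : Prop :=
  mpoly.meval (fun k => P (enum_val k)) p = 0.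

End Realizability.

Definition algebraic : Prop :=
  forall al : obs C -> finType, exists constraints : prob_poly al -> Prop,
    forall P : cond_dist al,
      realizable (cpt R) P <-> (forall p, constraints p -> satisfies P p).

Definition nonalgebraic : Prop := ~ algebraic.

(* The T-realizable distributions strictly contain the sT-realizable ones.    *)
Definition admits_gap (sT T : theory R) : Prop :=
  exists al : obs C -> finType,
    (forall P : cond_dist al, realizable sT P -> realizable T P)
    /\ (exists P : cond_dist al, realizable T P /\ ~ realizable sT P).

End CausalStructure.

(* Main.v *)
(* Choosing in every state space a basis on which the unit effect is          *)
(* constantly 1 turns a T-circuit into a classical circuit with the same      *)
(* probabilities whose gates are quasi-stochastic: columns sum to 1, but      *)
(* entries may be negative. Mixing each gate with weight 1 - t with the       *)
(* uniform noise channel makes all gates stochastic for small t > 0, so the   *)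
(* noisy distribution is then CPT-realizable and satisfies every equality     *)
(* constraint valid for CPT. A constraint evaluated on the noisy distribution *)
(* is a polynomial in t; having infinitely many zeros it vanishes, in         *)
(* particular at t = 1, where there is no noise. If the causal structure is   *)
(* algebraic, every T-realizable distribution is therefore CPT-realizable,    *)
(* hence sT-realizable, because symmetries act trivially on classical systems.*)
Require Import Defs.
From HB Require Import structures.
From mathcomp Require Import all_boot all_order all_algebra all_fingroup reals.
From mathcomp Require mpoly.
From mathcomp Require Import ring.

Set Implicit Arguments.
Unset Strict Implicit.
Unset Printing Implicit Defensive.

Import Order.TTheory GRing.Theory Num.Theory.
Local Open Scope ring_scope.

(** A circuit value is a contraction of tensors, so it does not change when matrices that cancel
    each other are inserted on the latent wires ([circuit_value_change_basis]). This carries two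
    steps: [quasistochastic_realization] chooses coordinates in which deterministic gates have
    column sums 1, and [cpt_realizable_swirl] moves classical circuits onto the classical systems of
    the swirled theory.

    Between them, [constraint_interpolation] passes from small noise to no noise along a polynomial
    in the mixing weight. Acyclicity enters through [circuit_value_sum1]: summing out the gates from
    the last one backwards shows that column sums 1 already normalize the circuit, whatever the
    signs of the entries. *)

Lemma bigA_distr_dffun (R : comNzRingType) (I : finType) (U : I -> finType)
    (F : forall i, U i -> R) :
  \prod_i \sum_(j : U i) F i j =
  \sum_(f : {dffun forall i, U i}) \prod_i F i (f i).
Proof.
(* Distributivity over functions needs a common codomain, so all [U i] are embedded in one sigma
   type; [fprod] then singles out the functions that choose from [U i] at each i. *)
under eq_bigr do rewrite big_tag.
rewrite bigA_distr_big_dep.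
transitivity (\sum_(t : fprod U) \prod_(i in I) [ffun j : U i => F i j] (t i)).
  rewrite big_fprod; apply: eq_bigr => g _; apply: eq_bigr => i _.
  by rewrite /untag; case: eqP => // e; rewrite ffunE.
rewrite (reindex _ (onW_bij _ (@fprod_of_dffun_bij I U))).
by apply: eq_bigr => f _; apply: eq_bigr => i _; rewrite ffunE fprodE.
Qed.

(** * Matrix calculus for linear maps in coordinates *)

Section Matrices.
Variable R : realType.
Implicit Types I J K : finType.

Lemma entry_hom_of I J (M : J -> I -> R) b a : entry (hom_of M) b a = M b a.
Proof.
pose f (v : vec R I) : vec R J := [ffun b => \sum_a M b a * v a].
have f_linear : linear f.
  move=> k u v; apply/ffunP => y; rewrite !ffunE scaler_sumr -big_split /=.
  by apply: eq_bigr => i _; rewrite !ffunE mulrDr /GRing.scale /= mulrCA.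
pose fL : {linear vec R I -> vec R J} :=
  HB.pack f (GRing.isLinear.Build _ _ _ _ f f_linear).
rewrite /entry /hom_of (lfunE fL) ffunE (bigD1 a) //= ffunE eqxx mulr1.
by rewrite big1 ?addr0 // => i /negPf ne; rewrite ffunE ne mulr0.
Qed.

Lemma vec_sum_basis I (v : vec R I) : v = \sum_a v a *: basis_vec R a.
Proof.
apply/ffunP => b; rewrite sum_ffunE (bigD1 b) //= !ffunE eqxx.
rewrite big1 ?addr0 /GRing.scale /= ?mulr1 // => i ne.
by rewrite !ffunE /GRing.scale /= eq_sym (negPf ne) mulr0.
Qed.

Lemma entry_comp I J K (g : 'Hom(vec R J, vec R K)) (f : 'Hom(vec R I, vec R J))
    c a : entry (g \o f)%VF c a = \sum_b entry g c b * entry f b a.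
Proof.
rewrite /entry comp_lfunE {1}[f _]vec_sum_basis linear_sum sum_ffunE.
by apply: eq_bigr => b _; rewrite linearZ /= !ffunE /GRing.scale /= mulrC.
Qed.

Lemma entryP I J (f g : 'Hom(vec R I, vec R J)) :
  (forall b a, entry f b a = entry g b a) -> f = g.
Proof.
move=> efg; apply/lfunP => v; rewrite [v]vec_sum_basis !linear_sum.
apply: eq_bigr => a _; rewrite !linearZ /=.
by have -> : f (basis_vec R a) = g (basis_vec R a) by apply/ffunP => b; apply: efg.
Qed.

End Matrices.

Lemma big_comp (R : realType) (T : theory R) (A B : sys T)
    (F : bas T (Defs.comp T A B) -> R) :
  \sum_z F z = \sum_a \sum_b F (join T (a, b)).
Proof.
have jbij : bijective (@join R T A B).
  by exists (@Defs.split R T A B); [apply: joinK | apply: Defs.splitK].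
rewrite pair_bigA (reindex _ (onW_bij _ jbij)).
by apply: eq_bigr => -[].
Qed.

(** * Basis elements of bundles as families of wire values *)

Section Bundles.
Variables (R : realType) (C : causal_structure) (al : obs C -> finType).
Variables (T : theory R) (sy : latent C -> sys T).

Lemma eq_bundle_val (v v' : forall w, bas T (wire_sys al sy w)) ws :
  (forall w, w \in ws -> v w = v' w) -> bundle_val v ws = bundle_val v' ws.
Proof.
elim: ws => //= w0 ws IH ev; rewrite ev ?mem_head // IH // => w wws.
by apply: ev; rewrite inE wws orbT.
Qed.

(** The tensor product of one linear functional per wire, in coordinates. *)
Fixpoint bundle_prod (f : forall w, bas T (wire_sys al sy w) -> R)
    (ws : seq (wire C)) : bas T (bundle al sy ws) -> R :=
  match ws with
  | [::] => fun _ => 1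
  | w :: ws' => fun z => f w (Defs.split T z).1 * bundle_prod f (Defs.split T z).2
  end.

Lemma bundle_prod_val f (v : forall w, bas T (wire_sys al sy w)) ws :
  bundle_prod f (bundle_val v ws) = \prod_(w <- ws) f w (v w).
Proof.
elim: ws => [|w ws IH]; first by rewrite big_nil.
by rewrite big_cons /= joinK IH.
Qed.

(** The family [v] lives on members of [ws] only, since other wires may have an empty basis. The
    second clause turns a nonvanishing product into a nonvanishing factor at each wire. *)
Lemma unbundle ws (z : bas T (bundle al sy ws)) : uniq ws ->
  {v : forall w, w \in ws -> bas T (wire_sys al sy w) |
    (forall v', (forall w (h : w \in ws), v' w = v w h) -> bundle_val v' ws = z)
    /\ (forall f, bundle_prod f z != 0 -> forall w h, f w (v w h) != 0)}.
Proof.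
elim: ws z => [|w0 ws IH] z /=.
  move=> _; exists (fun w (h : w \in [::]) => False_rect _ (notF h)).
  by split=> // v' _; rewrite [RHS]pt_unique.
case/andP=> w0ws /(IH (Defs.split T z).2)[v [vP fP]].
have tail w : w \in w0 :: ws -> w0 <> w -> w \in ws.
  by rewrite inE => /predU1P[->|].
exists (fun w h => match w0 =P w with
  | ReflectT e => eq_rect w0 (fun w => bas T (wire_sys al sy w)) (Defs.split T z).1 w e
  | ReflectF ne => v w (tail w h ne)
  end); split=> [v' ev|f].
  rewrite (vP v') => [|w h].
    have := ev w0 (mem_head _ _); case: eqP => // e; rewrite eq_axiomK /= => ->.
    by rewrite -surjective_pairing Defs.splitK.
  have h' : w \in w0 :: ws by rewrite inE h orbT.
  rewrite (ev w h'); case: eqP => [e|ne]; first by rewrite e h in w0ws.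
  by congr (v w _); apply: bool_irrelevance.
rewrite mulf_eq0 negb_or => /andP[f0 fne] w h.
by case: eqP => [e|ne]; [case: w / e {h} | apply: fP].
Qed.

Lemma unbundle_val (v : forall w, bas T (wire_sys al sy w)) ws (ws_uniq : uniq ws)
    w (h : w \in ws) :
  sval (unbundle (bundle_val v ws) ws_uniq) w h = v w.
Proof.
(* The indicator of [v] has product 1 on this bundle value, so no recovered component can differ
   from [v]. *)
have [_ /(_ (fun w a => (a == v w)%:R))] := svalP (unbundle (bundle_val v ws) ws_uniq).
rewrite bundle_prod_val big1 ?oner_neq0 => [/(_ isT w h)|i _]; last by rewrite eqxx.
by rewrite pnatr_eq0 eqb0 negbK => /eqP.
Qed.

End Bundles.

(** * Invariance of circuit values under a change of basis *)

Section ChangeOfBasis.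
Variables (R : realType) (C : causal_structure) (al : obs C -> finType).
Variables (T1 T2 : theory R) (sy1 : latent C -> sys T1) (sy2 : latent C -> sys T2).
Local Notation wire_mxs := (forall l, bas T2 (sy2 l) -> bas T1 (sy1 l) -> R).

(** Coordinates change on latent wires only; observed wires keep their classical value. *)
Definition wire_mx (m : wire_mxs) (w : wire C) :
    bas T2 (wire_sys al sy2 w) -> bas T1 (wire_sys al sy1 w) -> R :=
  match w with
  | inl l => m l
  | inr v => fun y z => (cl_out T2 y == cl_out T1 z)%:R
  end.

(** The Kronecker product of the wire matrices. *)
Fixpoint bundle_mx (m : wire_mxs) (ws : seq (wire C)) :
    bas T2 (bundle al sy2 ws) -> bas T1 (bundle al sy1 ws) -> R :=
  match ws with
  | [::] => fun _ _ => 1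
  | w :: ws' => fun y z =>
      wire_mx m (Defs.split T2 y).1 (Defs.split T1 z).1
      * bundle_mx m (Defs.split T2 y).2 (Defs.split T1 z).2
  end.

Lemma bundle_mx_val m (v : forall w, bas T2 (wire_sys al sy2 w)) ws z :
  bundle_mx m (bundle_val v ws) z = bundle_prod (fun w => wire_mx m (v w)) z.
Proof. by elim: ws z => //= w ws IH z; rewrite joinK IH. Qed.

Lemma sum_bundle_mx (m : wire_mxs) (g1 : forall w, bas T1 (wire_sys al sy1 w) -> R)
    (g2 : forall w, bas T2 (wire_sys al sy2 w) -> R) ws z :
  (forall w z, \sum_y g2 w y * wire_mx m y z = g1 w z) ->
  \sum_(y : bas T2 (bundle al sy2 ws)) bundle_prod g2 y * bundle_mx m y z
    = bundle_prod g1 z.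
Proof.
move=> g12; elim: ws z => [|w ws IH] z /=.
  rewrite (bigD1 (pt T2)) //= big1 ?addr0 ?mulr1 // => y.
  by rewrite (pt_unique y) eqxx.
rewrite big_comp -g12 -IH mulr_suml; apply: eq_bigr => a _.
by rewrite mulr_sumr; apply: eq_bigr => b _; rewrite joinK mulrACA.
Qed.

Lemma sum_bundle_mx_row (m : wire_mxs) (g1 : forall w, bas T1 (wire_sys al sy1 w) -> R)
    (g2 : forall w, bas T2 (wire_sys al sy2 w) -> R) ws y :
  (forall w y, \sum_z g1 w z * wire_mx m y z = g2 w y) ->
  \sum_(z : bas T1 (bundle al sy1 ws)) bundle_prod g1 z * bundle_mx m y z
    = bundle_prod g2 y.
Proof.
move=> g12; elim: ws y => [|w ws IH] y /=.
  rewrite (bigD1 (pt T1)) //= big1 ?addr0 ?mulr1 // => z.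
  by rewrite (pt_unique z) eqxx.
rewrite big_comp -g12 -IH mulr_suml; apply: eq_bigr => a _.
by rewrite mulr_sumr; apply: eq_bigr => b _; rewrite joinK mulrACA.
Qed.

(* Applied to the outputs and to the inputs of the gates, every latent wire   *)
(* being an output, and an input, of exactly one gate s l. Observed wires     *)
(* contribute a Kronecker delta, which forces their value x.                  *)
Lemma merge_gates (s : latent C -> gate C) (q : obs C -> pred (gate C)) (m : wire_mxs)
    (ws := fun g => enum [pred w : wire C | match w with
                                            | inl l => s l == g
                                            | inr v => q v g
                                            end])
    (c : {dffun forall l, bas T2 (sy2 l)}) (x : assignment al)
    (k : (forall g, bas T1 (bundle al sy1 (ws g))) -> R) :
  (forall z z', (forall g, z g = z' g) -> k z = k z') ->
  \sum_(z : {dffun forall g, bas T1 (bundle al sy1 (ws g))})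
     (\prod_g bundle_mx m (bundle_val (wire_val c x) (ws g)) (z g)) * k z =
  \sum_(b : {dffun forall l, bas T1 (sy1 l)})
     (\prod_l m l (c l) (b l)) * k (fun g => bundle_val (wire_val b x) (ws g)).
Proof.
(* Since [z] is a finite function while [k] takes plain functions, [kext] does the work of function
   extensionality. *)
move=> kext; pose P (z : {dffun forall g, bas T1 (bundle al sy1 (ws g))}) :=
  \prod_g bundle_mx m (bundle_val (wire_val c x) (ws g)) (z g).
under eq_bigr do rewrite -/(P _).
rewrite (bigID (fun z => P z != 0)) /= [X in _ + X]big1 ?addr0; last first.
  by move=> z /negbNE/eqP->; rewrite mul0r.
have ws_uniq g : uniq (ws g) by apply: enum_uniq.
have in_ws l : inl l \in ws (s l) by rewrite mem_enum inE.
pose h (b : {dffun forall l, bas T1 (sy1 l)}) :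
  {dffun forall g, bas T1 (bundle al sy1 (ws g))} :=
  [ffun g => bundle_val (wire_val b x) (ws g)].
pose h' (z : {dffun forall g, bas T1 (bundle al sy1 (ws g))}) :
  {dffun forall l, bas T1 (sy1 l)} :=
  [ffun l => sval (unbundle (z (s l)) (ws_uniq _)) (inl l) (in_ws l)].
have Ph b : P (h b) = \prod_l m l (c l) (b l).
  transitivity (\prod_g \prod_(l | s l == g) m l (c l) (b l)); last first.
    by rewrite [RHS](partition_big s xpredT).
  apply: eq_bigr => g _; rewrite ffunE bundle_mx_val bundle_prod_val /ws big_enum.
  rewrite big_sumType /= [X in _ * X]big1 ?mulr1 // => v _.
  by rewrite /= !cl_inK eqxx.
(* A nonzero weight forces every observed component of [z] to be its value in [x], so [z] is
   determined by its latent components [h' z]. *)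
rewrite (reindex_onto h h') => [|z Pz] /=; last first.
  apply/ffunP => g; rewrite ffunE.
  have Pg : bundle_mx m (bundle_val (wire_val c x) (ws g)) (z g) != 0.
    by move: Pz; rewrite /P => /prodf_neq0/(_ g isT).
  have [vP fP] := svalP (unbundle (z g) (ws_uniq g)).
  rewrite bundle_mx_val in Pg; have {fP}fP := fP _ Pg.
  apply: vP => -[l|v] hw /=.
    rewrite ffunE; have /eqP e : s l == g by move: hw; rewrite mem_enum inE.
    case: g / e Pg fP hw => _ _ hw; congr (sval _ _ _); exact: bool_irrelevance.
  have := fP _ hw; rewrite /= cl_inK pnatr_eq0 eqb0 negbK => /eqP->.
  by rewrite cl_outK.
rewrite [RHS](bigID (fun b => P (h b) != 0)) /= [X in _ = _ + X]big1 ?addr0; last first.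
  by move=> b /negbNE/eqP; rewrite Ph => ->; rewrite mul0r.
apply: eq_big => [b|b _]; last by rewrite Ph; congr (_ * _); apply: kext => g; rewrite ffunE.
case: (P (h b) != 0) => //=; apply/eqP/ffunP => l; rewrite ffunE.
rewrite [LHS](_ : _ = wire_val b x (inl l)) // -(unbundle_val _ (ws_uniq _) (in_ws l)).
by rewrite /h ffunE.
Qed.

Variables (a b : wire_mxs) (E : gate_maps al sy1).

Definition change_basis : gate_maps al sy2 := fun g =>
  hom_of (fun y y' => \sum_z \sum_z'
    bundle_mx a y z * entry (E g) z z' * bundle_mx b y' z').

Lemma circuit_value_change_basis x :
  (forall l i j, \sum_(c : bas T2 (sy2 l)) a c i * b c j = (i == j)%:R) ->
  circuit_value change_basis x = circuit_value E x.
Proof.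
move=> ab1; rewrite /circuit_value.
pose B1 := {dffun forall l, bas T1 (sy1 l)}.
pose B2 := {dffun forall l, bas T2 (sy2 l)}.
pose k (bo bi : B1) := \prod_g entry (E g) (bundle_val (wire_val bo x) (gate_out g))
                                         (bundle_val (wire_val bi x) (gate_in g)).
(* Each latent wire receives two old indices: [bo] from the gate that emits it and [bi] from the
   gate that consumes it. *)
transitivity (\sum_(c : B2) \sum_(bo : B1) \sum_(bi : B1)
    (\prod_l (a (c l) (bo l) * b (c l) (bi l))) * k bo bi).
  apply: eq_bigr => c _.
  pose K (z : forall g, bas T1 (bundle al sy1 (gate_out g))) := \prod_g \sum_z'
    entry (E g) (z g) z' * bundle_mx b (bundle_val (wire_val c x) (gate_in g)) z'.
  transitivity (\sum_(z : {dffun forall g, bas T1 (bundle al sy1 (gate_out g))})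
     (\prod_g bundle_mx a (bundle_val (wire_val c x) (gate_out g)) (z g)) * K z).
    under eq_bigr do rewrite entry_hom_of.
    rewrite bigA_distr_dffun; apply: eq_bigr => z _; rewrite -big_split /=.
    apply: eq_bigr => g _; rewrite mulr_sumr; apply: eq_bigr => z' _.
    by rewrite mulrA.
  rewrite (merge_gates (s := @src C) (q := fun v g => producer v == Some g)); last first.
    by move=> z z' ez; apply: eq_bigr => g _; rewrite ez.
  apply: eq_bigr => bo _; rewrite /K bigA_distr_dffun.
  pose K' (z : forall g, bas T1 (bundle al sy1 (gate_in g))) := \prod_g
    entry (E g) (bundle_val (wire_val bo x) (gate_out g)) (z g).
  transitivity ((\prod_l a (c l) (bo l)) *
     \sum_(z : {dffun forall g, bas T1 (bundle al sy1 (gate_in g))})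
     (\prod_g bundle_mx b (bundle_val (wire_val c x) (gate_in g)) (z g)) * K' z).
    congr (_ * _); apply: eq_bigr => z _.
    by rewrite -big_split; apply: eq_bigr => g _; rewrite mulrC.
  rewrite (merge_gates (s := @dst C) (q := fun v g => g \in feeds v)); last first.
    by move=> z z' ez; apply: eq_bigr => g _; rewrite ez.
  rewrite mulr_sumr; apply: eq_bigr => bi _.
  by rewrite mulrA -big_split.
rewrite exchange_big; apply: eq_bigr => bo _; rewrite exchange_big /=.
(* Summing over the new indices contracts [a] with [b] on every wire and so glues [bo] to [bi]. *)
have dirac (bi : B1) : \sum_(c : B2) (\prod_l (a (c l) (bo l) * b (c l) (bi l))) * k bo bi
    = (bo == bi)%:R * k bo bi.
  rewrite -mulr_suml; congr (_ * _).
  rewrite -(bigA_distr_dffun (fun l c => a c (bo l) * b c (bi l))).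
  under eq_bigr do rewrite ab1.
  case: eqP => [->|ne]; first by rewrite big1 // => l _; rewrite eqxx.
  have /existsP[l nel] : [exists l, bo l != bi l].
    apply: contra_notT ne => /existsPn eb; apply/ffunP => l.
    exact/eqP/negbNE/eb.
  by rewrite (bigD1 l) //= (negPf nel) mul0r.
under eq_bigr do rewrite dirac.
rewrite (bigD1 bo) //= eqxx mul1r big1 ?addr0 // => bi.
by rewrite eq_sym => /negPf->; rewrite mul0r.
Qed.

(** In matrix form the new gate is A E B^T. From g2 A = g1, g1 E = g1 and g1 B^T = g2 it follows
    that g2 A E B^T = g2. With unit effects as functionals, this transports determinism. *)
Lemma sum_change_basis (g1 : forall w, bas T1 (wire_sys al sy1 w) -> R)
    (g2 : forall w, bas T2 (wire_sys al sy2 w) -> R) g :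
  (forall w z, \sum_y g2 w y * wire_mx a y z = g1 w z) ->
  (forall w y, \sum_z g1 w z * wire_mx b y z = g2 w y) ->
  (forall z', \sum_z bundle_prod g1 z * entry (E g) z z' = bundle_prod g1 z') ->
  forall y', \sum_y bundle_prod g2 y * entry (change_basis g) y y' = bundle_prod g2 y'.
Proof.
move=> ga gb gE y'; rewrite -(sum_bundle_mx_row _ gb).
under [LHS]eq_bigr do rewrite entry_hom_of mulr_sumr.
rewrite exchange_big /=.
transitivity (\sum_z \sum_z' bundle_prod g1 z * entry (E g) z z' * bundle_mx b y' z').
  apply: eq_bigr => z _; under eq_bigr do rewrite mulr_sumr.
  rewrite exchange_big; apply: eq_bigr => z' _.
  rewrite -(sum_bundle_mx _ ga) !mulr_suml.
  by apply: eq_bigr => y _; rewrite !mulrA.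
by rewrite exchange_big; apply: eq_bigr => z' _; rewrite -mulr_suml gE.
Qed.

End ChangeOfBasis.

(** * Acyclicity and normalization of circuits *)

Section Acyclic.
Variable C : causal_structure.

Definition descendants (g : gate C) : nat := #|connect (@arrow C) g|.

Lemma arrow_descendants g h : arrow g h -> (descendants h < descendants g)%N.
Proof.
move=> gh; apply/proper_card/properP; split.
  by apply/subsetP => k; apply: connect_trans; apply: connect1.
exists g; first exact: connect0.
apply/negP => /connectP[p pp eg].
by have := @acyclic C (h :: p); rewrite /= rcons_path pp -eg gh => /(_ isT).
Qed.

Definition emitter (w : wire C) : option (gate C) :=
  match w with inl l => Some (src l) | inr v => producer v end.

Lemma mem_gate_out g w : (w \in gate_out g) = (emitter w == Some g).
Proof. by rewrite mem_enum inE; case: w. Qed.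

Lemma arrow_emitter g h w : emitter w = Some g -> w \in gate_in h -> arrow g h.
Proof.
rewrite mem_enum inE /arrow => eg wh; apply/orP.
case: w eg wh => [l|v] /= => [[<-]|eg] wh; [left|right]; apply/existsP.
  by exists l; rewrite wh eqxx.
by exists v; rewrite eg wh eqxx.
Qed.

End Acyclic.

Section Normalization.
Variables (R : realType) (C : causal_structure) (al : obs C -> finType).
Variables (T : theory R) (sy : latent C -> sys T) (M : gate_maps al sy).
Hypothesis M_sum1 : forall g y', \sum_y entry (M g) y y' = 1.
Local Notation valuation := {dffun forall w : wire C, bas T (wire_sys al sy w)}.
Local Notation inhab w := (exists a : bas T (wire_sys al sy w), true).

Lemma bundle_inhabited ws : (forall w, w \in ws -> inhab w) ->
  exists y : bas T (bundle al sy ws), true.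
Proof.
elim: ws => [|w ws IH] inh; first by exists (pt T).
have [a _] := inh w (mem_head _ _).
have [|y _] := IH; first by move=> w' h; apply: inh; rewrite inE h orbT.
by exists (join T (a, y)).
Qed.

Lemma wire_inhabited (i : input_assignment al) w : inhab w.
Proof.
(* Upstream gates have more descendants, so this induction reaches them first. Over an inhabited
   input bundle, an empty output bundle would give a column of sum 0. *)
have gate_ind n g : (#|gate C| - descendants g < n)%N ->
    forall w, emitter w = Some g -> inhab w.
  elim: n g => // n IH g gn {}w wg.
  have [|y' _] := @bundle_inhabited (gate_in g).
    move=> w' w'g; case e: (emitter w') => [h|].
      apply: (IH h) => //; have /arrow_descendants hg := arrow_emitter e w'g.
      rewrite ltnS in gn; apply: leq_trans gn; rewrite ltn_sub2l // (leq_trans hg) //.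
      exact: max_card.
    case: w' w'g e => [//|v] /= _ /eqP vo.
    by exists (cl_in T (i (Sub v vo))).
  have [y _|none] := pickP [pred y : bas T (bundle al sy (gate_out g)) | true].
    have wo : w \in gate_out g by rewrite mem_gate_out wg.
    by exists (sval (unbundle y (enum_uniq _)) w wo).
  have := M_sum1 y'; rewrite big_pred0 => // /esym/eqP.
  by rewrite (negPf (oner_neq0 _)).
case e: (emitter w) => [g|]; first exact: gate_ind (ltnSn _) _ e.
case: w e => [//|v] /= /eqP vo.
by exists (cl_in T (i (Sub v vo))).
Qed.

Let gate_entry g (v : valuation) : R :=
  entry (M g) (bundle_val v (gate_out g)) (bundle_val v (gate_in g)).

Let fixed_off (S : {set gate C}) (v d : valuation) :=
  [forall w, (if emitter w is Some g then g \in S else false) || (v w == d w)].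

(* Summing out the outputs of a gate of S with no successor in S leaves the   *)
(* sum for the remaining gates.                                               *)
Lemma sum_valuations (S : {set gate C}) d :
  \sum_(v | fixed_off S v d) \prod_(g in S) gate_entry g v = 1.
Proof.
elim: {S}_.+1 {-2}S (ltnSn #|S|) d => // n IH S Sn d.
have [->|[m0 m0S]] := set_0Vmem S.
  rewrite (big_pred1 d) => [|v]; first by rewrite big_set0.
  apply/forallP/eqP => [ev|-> w]; last by rewrite eqxx orbT.
  by apply/ffunP => w; have := ev w; case: emitter => [g|]; rewrite ?inE => /eqP.
pose m := [arg min_(g < m0 in S) descendants g].
have [mS mmin] : m \in S /\ forall g, g \in S -> ~~ arrow m g.
  rewrite /m; case: arg_minnP => // g gS gmin; split=> // h /gmin gh.
  by apply/negP => /arrow_descendants; rewrite ltnNge gh.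
pose S' := S :\ m.
have S'n : (#|S'| < n)%N by rewrite (cardsD1 m) mS in Sn.
(* [reset] forgets the outputs of [m]. On a fiber of [reset] the entries of the other gates of [S]
   are constant, and those of [m] run through one column. *)
pose reset (v : valuation) : valuation :=
  [ffun w => if emitter w == Some m then d w else v w].
have off_reset v : fixed_off S v d -> fixed_off S' (reset v) d.
  move=> /forallP off; apply/forallP => w; have := off w; rewrite ffunE.
  case: ifP => [_ _|]; first by rewrite eqxx orbT.
  by case: emitter => // g gm; rewrite !inE -[g == m]/(Some g == Some m) gm.
rewrite (partition_big reset (fun v' => fixed_off S' v' d) off_reset) -[RHS](IH S' S'n d).
apply: eq_bigr => v' off'.
pose y' := bundle_val v' (gate_in m).
transitivity (\sum_(v | fixed_off S v d && (reset v == v'))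
  \prod_(g in S') gate_entry g v' * entry (M m) (bundle_val v (gate_out m)) y').
  apply: eq_bigr => v /andP[_ /eqP ev]; rewrite /y' -ev.
  rewrite (big_setD1 m) //= mulrC; congr (_ * _).
    apply: eq_bigr => g; rewrite !inE => /andP[gm gS].
    congr (entry _ _ _); apply: eq_bundle_val => w; rewrite ffunE; last first.
      case: eqP => // wm wg.
      by have := mmin g gS; rewrite (arrow_emitter wm wg).
    by rewrite mem_gate_out => /eqP->; rewrite -[Some g == Some m]/(g == m) (negPf gm).
  congr (entry _ _ _); apply: eq_bundle_val => w; rewrite ffunE.
  case: eqP => // wm wg.
  by have := mmin m mS; rewrite (arrow_emitter wm wg).
rewrite -mulr_sumr -[RHS]mulr1; congr (_ * _).
rewrite -(M_sum1 y').
have out_uniq : uniq (gate_out m) by apply: enum_uniq.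
pose h (y : bas T (bundle al sy (gate_out m))) : valuation :=
  [ffun w => match boolP (w \in gate_out m) with
             | AltTrue wm => sval (unbundle y out_uniq) w wm
             | AltFalse _ => v' w
             end].
rewrite (reindex_onto h (fun v : valuation => bundle_val v (gate_out m))) /=; last first.
  move=> v /andP[_ /eqP ev]; apply/ffunP => w; rewrite ffunE.
  case: {-}_ / boolP => [wm|]; first by rewrite unbundle_val.
  by rewrite mem_gate_out -ev ffunE => /negPf->.
have hK y : bundle_val (h y) (gate_out m) = y.
  have [vP _] := svalP (unbundle y out_uniq); apply: vP => w wm; rewrite ffunE.
  case: {-}_ / boolP => [wm'|]; last by rewrite wm.
  by congr (sval _ _ _); apply: bool_irrelevance.
apply: eq_big => [y|y _]; last by rewrite hK.
rewrite hK eqxx andbT; apply/andP; split.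
  apply/forallP => w; rewrite ffunE.
  case: {-}_ / boolP => [wm|wm].
    have /eqP-> : emitter w == Some m by rewrite -mem_gate_out.
    by rewrite mS.
  have /forallP/(_ w) := off'.
  by case: emitter => // g; rewrite !inE => /orP[/andP[_ ->]|->]; rewrite ?orbT.
apply/eqP/ffunP => w; rewrite !ffunE; case: ifP => [/eqP wm|wm].
  by have /forallP/(_ w) := off'; rewrite wm !inE eqxx => /eqP.
case: {-}_ / boolP => // w_out; have : emitter w == Some m by rewrite -mem_gate_out.
by rewrite wm.
Qed.

Lemma circuit_value_sum1 (i : input_assignment al) :
  \sum_(x | agrees x i) circuit_value M x = 1.
Proof.
(* [sum_valuations] needs a value on every wire, but with all gates summed out only the open inputs
   stay fixed; elsewhere any inhabitant serves. *)
pose extends_input w : bas T (wire_sys al sy w) -> Prop :=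
  match w return bas T (wire_sys al sy w) -> Prop with
  | inl _ => fun _ => True
  | inr v => fun a => forall vo : open_input v, a = cl_in T (i (Sub v vo))
  end.
have [|d dP] := @fin_all_exists (wire C) _ extends_input.
  case=> [l|v]; first by have [a _] := wire_inhabited i (inl l); exists a.
  case: (boolP (open_input v)) => [vo|vno].
    by exists (cl_in T (i (Sub v vo))) => vo'; congr (cl_in T (i (Sub v _)));
       apply: bool_irrelevance.
  have [a _] := wire_inhabited i (inr v); exists a => vo.
  by rewrite vo in vno.
rewrite /circuit_value pair_big /=.
pose join_val (p : assignment al * {dffun forall l, bas T (sy l)}) : valuation :=
  [ffun w => wire_val p.2 p.1 w].
pose split_val (v : valuation) :
    assignment al * {dffun forall l, bas T (sy l)} :=
  ([ffun u => cl_out T (v (inr u) : bas T (cl T (al u)))], [ffun l => v (inl l)]).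
have split_valK v : join_val (split_val v) = v.
  by apply/ffunP => -[l|u]; rewrite ffunE /= ffunE // cl_outK.
have join_valK p : split_val (join_val p) = p.
  case: p => x b; rewrite /split_val; congr (_, _); apply/ffunP => a; rewrite !ffunE //=.
  by rewrite cl_inK.
rewrite -[RHS](sum_valuations setT (finfun d)).
rewrite [RHS](reindex join_val) /=; last first.
  by exists split_val => p _; [apply: join_valK | apply: split_valK].
apply: eq_big => [[x b]|[x b] _] /=.
  rewrite andbT; apply/forallP/forallP => [xi|xi v].
    move=> [l|u] /=; first by rewrite inE.
    rewrite !ffunE /=; case e: (producer u) => [g|]; first by rewrite inE.
    have uo : open_input u by rewrite /open_input e.
    by rewrite (dP (inr u) uo) /= -(eqP (xi (Sub u uo))).
  case: v => v vo; have := xi (inr v); have /eqP e := vo; rewrite /= e /= !ffunE.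
  by rewrite (dP (inr v) vo) /= => /eqP/(congr1 (cl_out T)); rewrite !cl_inK => ->.
apply: eq_big => [g|g _]; first by rewrite inE.
by rewrite /gate_entry; congr (entry _ _ _); apply: eq_bundle_val => w _; rewrite ffunE.
Qed.

End Normalization.

(** * Determinism as column sums, and quasi-stochastic circuits *)

Section Classical.
Variable R : realType.

Lemma sum_cl_out (T : theory R) (X : finType) (k : X) :
  \sum_(y : bas T (cl T X)) (cl_out T y == k)%:R = 1 :> R.
Proof.
rewrite (bigD1 (cl_in T k)) //= cl_inK eqxx big1 ?addr0 // => y.
by apply: contraNeq; rewrite pnatr_eq0 eqb0 negbK => /eqP<-; rewrite cl_outK.
Qed.

Lemma cpt_deterministicP (A B : sys (cpt R))
    (f : 'Hom(vec R (bas (cpt R) A), vec R (bas (cpt R) B))) :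
  deterministic f <-> forall a, \sum_b entry f b a = 1.
Proof.
have unit1 S y a : entry (unit_eff (cpt R) S) y a = 1 by rewrite entry_hom_of.
split=> [df a|f1].
  rewrite -(unit1 A tt a) -df entry_comp.
  by apply: eq_bigr => b _; rewrite unit1 mul1r.
apply: entryP => y a; rewrite entry_comp unit1 -(f1 a).
by apply: eq_bigr => b _; rewrite unit1 mul1r.
Qed.

End Classical.

Lemma bundle_prod1 (R : realType) (C : causal_structure) (al : obs C -> finType)
    (T : theory R) (sy : latent C -> sys T) ws (z : bas T (bundle al sy ws)) :
  bundle_prod (fun _ _ => 1) z = 1.
Proof. by elim: ws z => //= w ws IH z; rewrite IH mul1r. Qed.

Section UnitBundle.
Variables (R : realType) (C : causal_structure) (al : obs C -> finType).
Variables (T : theory R) (gptT : tomographically_local_gpt T) (sy : latent C -> sys T).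

Definition unit_weight (w : wire C) (z : bas T (wire_sys al sy w)) : R :=
  entry (unit_eff T _) (pt T) z.

Lemma entry_unit_bundle ws (z : bas T (bundle al sy ws)) :
  entry (unit_eff T _) (pt T) z = bundle_prod unit_weight z.
Proof.
elim: ws z => [|w ws IH] z /=.
  by rewrite (gpt_unit_classical gptT) //; apply: classical_triv.
by rewrite (gpt_unit_comp gptT) IH.
Qed.

Lemma deterministic_bundleP ws ws'
    (f : 'Hom(vec R (bas T (bundle al sy ws)), vec R (bas T (bundle al sy ws')))) :
  deterministic f <->
  forall z, \sum_y bundle_prod unit_weight y * entry f y z = bundle_prod unit_weight z.
Proof.
split=> [df z|fz].
  rewrite -entry_unit_bundle -df entry_comp.
  by apply: eq_bigr => y _; rewrite entry_unit_bundle.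
apply: entryP => k z; rewrite (pt_unique k) entry_comp entry_unit_bundle -fz.
by apply: eq_bigr => y _; rewrite entry_unit_bundle.
Qed.

End UnitBundle.

(* [a] and the transpose of [b] are the coordinate changes to and from a basis*)
(* on which the functional u is constantly 1. When u = 0 no such basis exists *)
(* and n is empty.                                                            *)
Lemma normalizing_basis (R : realType) (I : finType) (u : I -> R) :
  {n : finType & {a : n -> I -> R & {b : n -> I -> R |
    [/\ forall i, \sum_c a c i = u i,
        forall c, \sum_i u i * b c i = 1
      & n -> forall i j, \sum_c a c i * b c j = (i == j)%:R]}}}.
Proof.
case: (pickP (fun i => u i != 0)) => [i0 u0|u0]; last first.
  exists void, (fun _ _ => 0), (fun _ _ => 0); split=> [i|[]|[]].
  by rewrite big1 => [|[]] //; have /negbFE/eqP-> := u0 i.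
(* a = 1 + e (u - 1)^T with e the basis vector of i0, inverted by the         *)
(* Sherman-Morrison formula.                                                  *)
pose a (c i : I) : R := (c == i)%:R + (c == i0)%:R * (u i - 1).
pose b (c i : I) : R := (i == c)%:R - (i == i0)%:R * ((u c - 1) / u i0).
have dirac (k : I) (f : I -> R) : \sum_c (c == k)%:R * f c = f k.
  rewrite (bigD1 k) //= eqxx mul1r big1 ?addr0 // => c /negPf->.
  by rewrite mul0r.
exists I, a, b; split=> [i|c|_ i j].
- rewrite big_split /= dirac -(eq_bigr _ (fun c _ => mulr1 (c == i)%:R)) dirac.
  by rewrite addrC subrK.
- under eq_bigr do rewrite mulrBr [u _ * (_ == c)%:R]mulrC mulrCA.
  by rewrite sumrB !dirac mulrC divfK // opprB addrC subrK.
under eq_bigr do rewrite mulrDl -mulrA.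
rewrite big_split /= !dirac /b [i == j]eq_sym.
by case: (j == i0); case: (j == i); rewrite /=; field.
Qed.

(** In a normalizing basis on each latent wire the unit effect is constantly 1, so determinism
    becomes column sums 1. [M] is merely typed over [cpt]; its gates need not be valid there. *)
Lemma quasistochastic_realization (R : realType) (T : theory R) (C : causal_structure)
    (al : obs C -> finType) (P : cond_dist R al) :
  tomographically_local_gpt T -> realizable T P ->
  exists (sy : latent C -> sys (cpt R)) (M : gate_maps al sy),
    (forall g y', \sum_y entry (M g) y y' = 1) /\ forall x, P x = circuit_value M x.
Proof.
move=> gptT [sy [E [_ Edet PE]]].
pose nb l := normalizing_basis (fun i : bas T (sy l) => entry (unit_eff T _) (pt T) i).
pose sy' l : sys (cpt R) := projT1 (nb l).
pose a l : bas (cpt R) (sy' l) -> bas T (sy l) -> R := projT1 (projT2 (nb l)).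
pose b l : bas (cpt R) (sy' l) -> bas T (sy l) -> R := sval (projT2 (projT2 (nb l))).
pose M : gate_maps al sy' := change_basis a b E.
have M1 g y' : \sum_y entry (M g) y y' = 1.
  rewrite -(bundle_prod1 y')
    -(@sum_change_basis _ _ _ _ _ _ _ a b E (@unit_weight _ _ _ _ _) (fun _ _ => 1) g).
  - by apply: eq_bigr => y _; rewrite bundle_prod1 mul1r.
  - case=> [l|v] z /=.
      have [ua _ _] := svalP (projT2 (projT2 (nb l))).
      by rewrite /unit_weight /= -ua; apply: eq_bigr => y _; rewrite mul1r.
    rewrite /unit_weight (gpt_unit_classical gptT); last exact: classical_cl.
    rewrite -[RHS](sum_cl_out (cpt R) (cl_out T z)).
    by apply: eq_bigr => y _; rewrite mul1r.
  - case=> [l|v] y /=; first by have [_ ub _] := svalP (projT2 (projT2 (nb l))); apply: ub.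
    rewrite -[RHS](sum_cl_out T (y : al v)).
    apply: eq_bigr => z _; rewrite /unit_weight (gpt_unit_classical gptT).
      by rewrite mul1r eq_sym.
    exact: classical_cl.
  - by move=> z'; have [_ /(deterministic_bundleP gptT)] := Edet g.
exists sy', M; split=> // x; rewrite PE; apply/esym/circuit_value_change_basis => l i j.
(* A wire with zero unit effect would be empty in the circuit M, whereas the  *)
(* columns of M sum to 1, so no wire of M is empty.                           *)
pose i0 : input_assignment al := [ffun v => x (val v)].
have [c _] := wire_inhabited M1 i0 (inl l).
by have [_ _ ab] := svalP (projT2 (projT2 (nb l))); apply: ab.
Qed.

(** * Mixing with noise and polynomial interpolation *)

Section Interpolation.
Variables (R : realType) (C : causal_structure) (al : obs C -> finType).
Variables (sy : latent C -> sys (cpt R)) (M : gate_maps al sy).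
Hypothesis M1 : forall g y', \sum_y entry (M g) y y' = 1.

Let n g : R := #|bas (cpt R) (bundle al sy (gate_out g))|%:R.

Definition noisy (t : R) : gate_maps al sy :=
  fun g => hom_of (fun y y' => (1 - t) * (n g)^-1 + t * entry (M g) y y').

Definition noisy_poly (x : assignment al) : {poly R} :=
  \sum_(b : {dffun forall l, bas (cpt R) (sy l)}) \prod_g
    ((1 - 'X) * ((n g)^-1)%:P
     + 'X * (entry (M g) (bundle_val (wire_val b x) (gate_out g))
                         (bundle_val (wire_val b x) (gate_in g)))%:P).

Lemma horner_noisy x t : (noisy_poly x).[t] = circuit_value (noisy t) x.
Proof.
rewrite horner_sum; apply: eq_bigr => b _; rewrite horner_prod.
by apply: eq_bigr => g _; rewrite entry_hom_of !hornerE.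
Qed.

Lemma noisy_sum1 t g y' : \sum_y entry (noisy t g) y y' = 1.
Proof.
under eq_bigr do rewrite entry_hom_of.
rewrite big_split /= sumr_const -mulr_sumr M1 mulr1 -[_ *+ _]mulr_natr -mulrA.
rewrite mulVf ?mulr1 ?subrK // pnatr_eq0; apply/eqP => /card0_eq none.
by have /eqP := M1 y'; rewrite big_pred0 // eq_sym (negPf (oner_neq0 _)).
Qed.

(** With m an entry of [M g], (1 - t)/n + t m = (1 - t (1 - n m))/n, which is nonnegative once t |1
    - n m| is at most 1. [K] bounds all these absolute values at once, and its summand 1 makes it
    positive. *)
Let K : R := 1 + \sum_g \sum_y \sum_y' `|1 - n g * entry (M g) y y'|.

Lemma noisy_ge0 t g y y' : 0 <= t -> t * K <= 1 -> 0 <= entry (noisy t g) y y'.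
Proof.
move=> t0 tK; rewrite entry_hom_of.
have n0 : n g != 0 by rewrite pnatr_eq0; apply/eqP => /card0_eq/(_ y).
rewrite [X in 0 <= X](_ : _ = (n g)^-1 * (1 - t * (1 - n g * entry (M g) y y'))).
  rewrite mulr_ge0 ?invr_ge0 ?ler0n // subr_ge0 (le_trans _ tK) // ler_wpM2l //.
  apply: le_trans (ler_norm _) _; rewrite /K (bigD1 g) //= (bigD1 y) //= (bigD1 y') //=.
  by rewrite addrCA -!addrA lerDl !addr_ge0 ?ler01 ?sumr_ge0 // => *;
    rewrite ?sumr_ge0 // => *; rewrite sumr_ge0.
by rewrite /n; field.
Qed.

Lemma constraint_interpolation (P : cond_dist R al) (p : prob_poly R al) :
  (forall x, P x = circuit_value M x) ->
  (forall Q : cond_dist R al, realizable (cpt R) Q -> satisfies Q p) ->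
  satisfies P p.
Proof.
move=> PM sat.
pose q : {poly R} := mpoly.mmap (fun c => c%:P) (fun k => noisy_poly (enum_val k)) p.
have horner_q t : q.[t] = mpoly.meval (fun k => circuit_value (noisy t) (enum_val k)) p.
  rewrite /q /mpoly.mmap horner_sum; apply: eq_bigr => m _.
  rewrite hornerM hornerC horner_prod; congr (_ * _); apply: eq_bigr => k _.
  by rewrite horner_exp horner_noisy.
have K1 : 1 <= K.
  by rewrite lerDl !sumr_ge0 // => g _; rewrite sumr_ge0 // => y _; rewrite sumr_ge0.
have K0 k : 0 < K + k%:R by rewrite (lt_le_trans ltr01) // (le_trans K1) // lerDl ler0n.
(* These points are distinct and satisfy [t * K <= 1], so the noisy circuit there is stochastic and
   realizes a genuine distribution [Q]. *)
have root_q k : root q (K + k%:R)^-1.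
  set t := _^-1.
  have t0 : 0 <= t by rewrite invr_ge0 ltW.
  have tK : t * K <= 1 by rewrite mulrC ler_pdivrMr // mul1r lerDl ler0n.
  have Q0 x : 0 <= circuit_value (noisy t) x.
    by apply: sumr_ge0 => b _; apply: prodr_ge0 => g _; apply: noisy_ge0.
  pose Q := CondDist Q0 (circuit_value_sum1 (noisy_sum1 t)).
  rewrite rootE horner_q; apply/eqP; apply: (sat Q).
  exists sy, (noisy t); split=> // [l _|g]; first exact: (@classical_cl R (cpt R)).
  split; last exact/cpt_deterministicP/noisy_sum1.
  by split=> [y y'|y']; [apply: noisy_ge0 | rewrite noisy_sum1].
(* A nonzero [q] has degree [size q] - 1, hence fewer than [size q] distinct roots. *)
have q0 : q = 0.
  apply/eqP; apply: contraT => qn0.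
  have := max_poly_roots qn0 (rs := [seq (K + k%:R)^-1 | k <- iota 0 (size q)]).
  rewrite size_map size_iota ltnn; apply; first by apply/allP => _ /mapP[k _ ->].
  rewrite map_inj_uniq ?iota_uniq // => i j /invr_inj/addrI/eqP.
  by rewrite eqr_nat => /eqP.
have := horner_q 1; rewrite q0 horner0 /satisfies => ->.
apply: eq_bigr => m _; congr (_ * _); apply: eq_bigr => k _; congr (_ ^+ _).
rewrite PM; apply: eq_bigr => b _; apply: eq_bigr => g _.
by rewrite entry_hom_of subrr mul0r add0r mul1r.
Qed.

End Interpolation.

(** * From classical to swirled circuits, and the conclusion *)

Lemma cpt_realizable_swirl (R : realType) (T : theory R) (gT : finGroupType)
    (F : forall S : sys T, gT -> 'End(vec R (bas T S))) (C : causal_structure)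
    (al : obs C -> finType) (P : cond_dist R al) :
  tomographically_local_gpt T -> symmetry F ->
  realizable (cpt R) P -> realizable (swirl F) P.
Proof.
move=> gptT symF [sy' [E [_ Edet PE]]].
pose sy l : sys T := cl T (sy' l).
(* The matrix of a bijection has its transpose as inverse, so [a] serves for both coordinate
   changes. *)
pose a l (y : bas T (sy l)) (z : bas (cpt R) (sy' l)) : R := (cl_out T y == z)%:R.
pose E' : gate_maps al sy := change_basis a a E.
have bundle_classical ws : classical (bundle al sy ws).
  elim: ws => [|[l|v] ws IH]; first exact: classical_triv.
    by apply: classical_comp => //; apply: classical_cl.
  by apply: classical_comp => //; apply: classical_cl.
have a_ge0 ws (y : bas T (bundle al sy ws)) (z : bas (cpt R) (bundle al sy' ws)) :
    0 <= bundle_mx a y z.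
  by elim: ws y z => //= -[l|v] ws IH y z; rewrite mulr_ge0 ?ler0n.
have E'1 g y' : \sum_y entry (E' g) y y' = 1.
  rewrite -(bundle_prod1 y')
    -(@sum_change_basis _ _ _ _ _ _ _ a a E (fun _ _ => 1) (fun _ _ => 1) g).
  - by apply: eq_bigr => y _; rewrite bundle_prod1 mul1r.
  - by case=> [l|v] z /=; under eq_bigr do rewrite mul1r; apply: sum_cl_out.
  - case=> [l|v] y /=; rewrite -[RHS](sum_cl_out (cpt R) (cl_out T y));
      by apply: eq_bigr => z _; rewrite mul1r eq_sym.
  - move=> z'; have [_ /cpt_deterministicP/(_ z') E1] := Edet g.
    by rewrite bundle_prod1 -[RHS]E1; apply: eq_bigr => z _; rewrite bundle_prod1 mul1r.
have E'_valid g : valid T (E' g) /\ covariant F (E' g) /\ deterministic (E' g).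
  split; [|split].
  - apply/(gpt_classical gptT) => //; split=> [y y'|y']; last by rewrite E'1.
    rewrite entry_hom_of; apply: sumr_ge0 => z _; apply: sumr_ge0 => z' _.
    by rewrite !mulr_ge0 //; have [[]] := Edet g.
  (* All bundles are classical, so covariance only says that the gate commutes with identities. *)
  - by move=> h; rewrite !(sym_classical symF) // comp_lfun1r comp_lfun1l.
  - apply: entryP => k y'; rewrite (pt_unique k) entry_comp.
    rewrite (gpt_unit_classical gptT) // -(E'1 g y'); apply: eq_bigr => y _.
    by rewrite (gpt_unit_classical gptT) // mul1r.
exists sy, E'; split=> [l _|g|x].
- exact: (@classical_cl R (swirl F)).
- by have [? []] := E'_valid g.
- rewrite PE; apply/esym; apply: (@circuit_value_change_basis _ _ _ (cpt R) T sy' sy) => l i j.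
  rewrite (bigD1 (cl_in T i)) //= /a cl_inK eqxx mul1r big1 ?addr0 // => c ci.
  suff /negPf-> : cl_out T c != i by rewrite mul0r.
  by apply: contraNneq ci => <-; rewrite cl_outK.
Qed.

Theorem corollary2 (R : realType) (T : theory R) (gT : finGroupType)
    (F : forall S : sys T, gT -> 'End(vec R (bas T S)))
    (C : causal_structure) :
  tomographically_local_gpt T ->
  symmetry F ->
  nonphysical F ->
  admits_gap C (swirl F) T ->
  nonalgebraic R C.
Proof.
move=> gptT symF _ [al [_ [P [TP nsP]]]] algC.
apply: nsP; apply: cpt_realizable_swirl => //.
(* One direction of algebraicity reduces CPT-realizability of [P] to its constraints; the other says
   that each constraint holds for all CPT-realizable distributions, as interpolation requires. *)
have [constraints cptP] := algC al; apply/cptP => p pc.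
have [sy [M [M1 PM]]] := quasistochastic_realization gptT TP.
by apply: (constraint_interpolation M1 PM) => Q /cptP; apply.
Qed.
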